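(* Let $H$ be a Hadamard manifold, $E\subseteq H$ a nonempty open geodesic convex set, $\phi_s:E\to\mathbb{I}$, $\phi_s(p)=[\phi_s^L(p),\phi_s^U(p)]$, $s\in\{1,\dots,l\}$, and $\psi_u:E\to\mathbb{R}$, $u\in\{1,\dots,t\}$, $F=\{p\in E:\psi_u(p)\le0,\ u=1,\dots,t\}$, and consider the problem (MIVOP2) of minimizing $\phi=(\phi_1,\dots,\phi_l)$ over $F$. Let $\bar p\in F$ and $J(\bar p)=\{u\in\{1,\dots,t\}:\psi_u(\bar p)=0\}$. Assume that all $\psi_u$ are directionally differentiable at $\bar p$, that $\psi_u$, $u\in J(\bar p)$, are strictly pseudo-convex at $\bar p$, and that the $\phi_s$, $s\in\{1,\dots,l\}$, are weakly directionally differentiable at $\bar p$. (a) If the $\phi_s$, $s\in\{1,\dots,l\}$, are LU-strictly pseudo-convex at $\bar p$ and for every feasible point $p\in F$ there exist real numbers $\lambda_s^L>0,\lambda_s^U>0$, $s\in\{1,\dots,l\}$, and $\mu_u^L\ge0,\mu_u^U\ge0$, $u\in\{1,\dots,t\}$, such that (i) $\sum_{s=1}^{l}\lambda_s^L(\phi_s^L)'(\bar p;\exp_{\bar p}^{-1}p)+\sum_{u=1}^{t}\mu_u^L\psi_u'(\bar p;\exp_{\bar p}^{-1}p)\ge0$; (ii) $\sum_{s=1}^{l}\lambda_s^U(\phi_s^U)'(\bar p;\exp_{\bar p}^{-1}p)+\sum_{u=1}^{t}\mu_u^U\psi_u'(\bar p;\exp_{\bar p}^{-1}p)\ge0$; (iii)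 $\mu_u^L\psi_u(\bar p)=0=\mu_u^U\psi_u(\bar p)$, $u\in\{1,\dots,t\}$, then $\bar p$ is a type-I Pareto optimal solution of (MIVOP2). (b) If the $\phi_s$, $s\in\{1,\dots,l\}$, are CW-strictly pseudo-convex at $\bar p$ and for every feasible point $p\in F$ there exist real numbers $\lambda_s^C>0,\lambda_s^W>0$, $s\in\{1,\dots,l\}$, and $\mu_u^C\ge0,\mu_u^W\ge0$, $u\in\{1,\dots,t\}$, such that (iv) $\sum_{s=1}^{l}\lambda_s^C(\phi_s^C)'(\bar p;\exp_{\bar p}^{-1}p)+\sum_{u=1}^{t}\mu_u^C\psi_u'(\bar p;\exp_{\bar p}^{-1}p)\ge0$; (v) $\sum_{s=1}^{l}\lambda_s^W(\phi_s^W)'(\bar p;\exp_{\bar p}^{-1}p)+\sum_{u=1}^{t}\mu_u^W\psi_u'(\bar p;\exp_{\bar p}^{-1}p)\ge0$; (vi) $\mu_u^C\psi_u(\bar p)=0=\mu_u^W\psi_u(\bar p)$, $u\in\{1,\dots,t\}$, then $\bar p$ is a type-II Pareto optimal solution of (MIVOP2).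
   Context: A Hadamard manifold $H$ is a complete simply connected Riemannian manifold of non-positive sectional curvature; for $p\in H$ the map $\exp_p:T_p(H)\to H$ is a diffeomorphism with inverse $\exp_p^{-1}$, and the geodesic joining $p$ to $q$ is $\gamma_{p,q}(\alpha)=\exp_p(\alpha\exp_p^{-1}q)$, $\alpha\in[0,1]$. A set $E\subseteq H$ is geodesic convex if $\gamma_{p,q}(\alpha)\in E$ for all $p,q\in E$, $\alpha\in[0,1]$. The feasible set $F$ is assumed geodesic convex. For $f:E\to\mathbb{R}$, the directional derivative is $f'(p;w)=\lim_{\alpha\to0^+}\frac{f(\exp_p(\alpha w))-f(p)}{\alpha}$, $w\in T_p(H)$; $f$ is directionally differentiable at $p$ if it exists (finite) for all $w\in T_p(H)$. A directionally differentiable $f$ is strictly pseudo-convex at $\bar p\in E$ if for every $p\in E$ with $p\neq\bar p$, $f(p)\le f(\bar p)$ implies $f'(\bar p;\exp_{\bar p}^{-1}p)<0$; here only directional differentiability at $\bar p$ is required. $\mathbb{I}$ is the set of closed bounded intervals of $\mathbb{R}$. For $T=[t^L,t^U]$ put $t^C=\frac12(t^L+t^U)$, $t^W=\frac12(t^U-t^L)$. $T\leqq_{LU}S$ iff $t^L\le s^L$ and $t^U\le s^U$; $T\leqq_{CW}S$ iff $t^C\le s^C$ and $t^W\le s^W$; for either order, $T<S$ means $T\leqq S$ and $T\ne S$. For tuples of intervals and either order, $T<S$ means $T_k\leqq S_k$ for all $k$ and $T_h<S_h$ for at least one $h$. For $f=[f^L,f^U]:E\to\mathbb{I}$ put $f^C=\frac12(f^L+f^U)$,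 $f^W=\frac12(f^U-f^L)$. $f$ is weakly directionally differentiable at $p$ if $f^L$ and $f^U$ are directionally differentiable at $p$. Such an $f$ is LU-strictly pseudo-convex at $\bar p$ if $f^L$ and $f^U$ are strictly pseudo-convex at $\bar p$, and CW-strictly pseudo-convex at $\bar p$ if $f^C$ and $f^W$ are strictly pseudo-convex at $\bar p$. $\bar p\in F$ is a type-I (resp. type-II) Pareto optimal solution of (MIVOP2) if there is no $\hat p\in F$ with $\phi(\hat p)<_{LU}\phi(\bar p)$ (resp. $\phi(\hat p)<_{CW}\phi(\bar p)$). *)

(* Defs.v *)
From HB Require Import structures.
From mathcomp Require Import all_boot all_order all_algebra.
From mathcomp Require Import all_classical all_reals all_analysis.

Set Implicit Arguments.
Unset Strict Implicit.
Unset Printing Implicit Defensive.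

Import Order.TTheory GRing.Theory Num.Theory.
Import numFieldNormedType.Exports.

Local Open Scope classical_set_scope.
Local Open Scope ring_scope.

(* C^k on A through iterated partial derivatives; only meaningful for A open. *)
Fixpoint Ck (R : realType) n (V : normedModType R) (k : nat)
    (A : set 'rV[R]_n) (f : 'rV[R]_n -> V) : Prop :=
  if k is k'.+1 then
    forall i : 'I_n, (forall x, A x -> derivable f x (delta_mx 0 i)) /\
      Ck k' A (fun x => 'D_(delta_mx 0 i) f x)
  else {in A, continuous f}.

Definition smooth (R : realType) n (V : normedModType R)
    (A : set 'rV[R]_n) (f : 'rV[R]_n -> V) : Prop := forall k, Ck k A f.

(* A homeomorphism between open sets; [to_coord] and [of_coord] are total, and
   their values outside [dom] and [cod] are irrelevant. *)
Record chart (R : realType) (n : nat) (T : topologicalType) := Chart {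
  dom : set T;
  cod : set 'rV[R]_n;
  to_coord : T -> 'rV[R]_n;
  of_coord : 'rV[R]_n -> T;
  dom_open : open dom;
  cod_open : open cod;
  to_coord_fun : set_fun dom cod to_coord;
  of_coord_fun : set_fun cod dom of_coord;
  to_coordK : {in dom, cancel to_coord of_coord};
  of_coordK : {in cod, cancel of_coord to_coord};
  to_coord_continuous : {in dom, continuous to_coord};
  of_coord_continuous : {in cod, continuous of_coord} }.

Definition overlap (R : realType) n (T : topologicalType) (c d : chart R n T) :
  set 'rV[R]_n := cod c `&` of_coord c @^-1` dom d.

Definition transition (R : realType) n (T : topologicalType)
  (c d : chart R n T) : 'rV[R]_n -> 'rV[R]_n := to_coord d \o of_coord c.

Definition inner (R : realType) n (A : 'M[R]_n) (u v : 'rV[R]_n) : R :=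
  (u *m A *m v^T) 0 0.

(* The atlas is given with a preferred chart [chart_at p] around each point p,
   and a tangent vector at p is represented by its coordinates in that chart:
   T_p M is 'rV[R]_n.  [metric p x] is the Gram matrix of the Riemannian metric
   in the coordinates of [chart_at p], at the point of coordinates x.
   The Jacobian ''J f x' acts on row vectors by right multiplication, whence
   the form of the change-of-chart formula. *)
Record riemannianManifold (R : realType) (n : nat) := RiemannianManifold {
  points :> topologicalType;
  points_hausdorff : hausdorff_space points;
  points_second_countable : @second_countable points;
  chart_at : points -> chart R n points;
  chart_at_dom : forall p, dom (chart_at p) p;
  transition_smooth : forall p q,
    smooth (overlap (chart_at p) (chart_at q))
           (transition (chart_at p) (chart_at q));
  metric : points -> 'rV[R]_n -> 'M[R]_n;
  metric_smooth : forall p, smooth (cod (chart_at p)) (metric p);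
  metric_sym : forall p x, cod (chart_at p) x -> (metric p x)^T = metric p x;
  metric_pos : forall p x, cod (chart_at p) x ->
    forall u : 'rV[R]_n, u != 0 -> 0 < inner (metric p x) u u;
  metric_transition : forall p q x, overlap (chart_at p) (chart_at q) x ->
    let f := transition (chart_at p) (chart_at q) in
    metric p x = 'J f x *m metric q (f x) *m ('J f x)^T }.

Section LocalGeometry.
Context (R : realType) (n : nat) (G : 'rV[R]_n -> 'M[R]_n).

Definition partial (i : 'I_n) (f : 'rV[R]_n -> R) (x : 'rV[R]_n) : R :=
  'D_(delta_mx 0 i) f x.

(* Gamma^k_{ij}, the Christoffel symbols of the Levi-Civita connection of G *)
Definition christoffel (x : 'rV[R]_n) (k i j : 'I_n) : R :=
  2^-1 * \sum_(m < n) invmx (G x) k m *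
    (partial i (fun y => G y j m) x + partial j (fun y => G y i m) x
     - partial m (fun y => G y i j) x).

(* The component along e_l of R(e_i, e_j) e_k, with the sign convention
   R(X, Y) Z = nabla_X nabla_Y Z - nabla_Y nabla_X Z - nabla_[X, Y] Z *)
Definition curvature_coef (x : 'rV[R]_n) (i j k l : 'I_n) : R :=
  partial i (fun y => christoffel y l j k) x
  - partial j (fun y => christoffel y l i k) x
  + \sum_(m < n) (christoffel x m j k * christoffel x l i m
                  - christoffel x m i k * christoffel x l j m).

Definition curvature (x u v w : 'rV[R]_n) : 'rV[R]_n :=
  \row_l \sum_(i < n) \sum_(j < n) \sum_(k < n)
    u 0 i * v 0 j * w 0 k * curvature_coef x i j k l.

Definition sectional_curvature (x u v : 'rV[R]_n) : R :=
  inner (G x) (curvature x u v v) u /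
  (inner (G x) u u * inner (G x) v v - inner (G x) u v ^+ 2).

Definition geodesic_eq (x : R -> 'rV[R]_n) (t : R) : Prop :=
  [/\ \forall s \near t, derivable x s 1,
      derivable (derive1 x) t 1 &
      forall k : 'I_n, derive1 (derive1 x) t 0 k
        + \sum_(i < n) \sum_(j < n)
            christoffel (x t) k i j * derive1 x t 0 i * derive1 x t 0 j = 0].

End LocalGeometry.

Definition simply_connected (R : realType) (T : topologicalType) : Prop :=
  (forall p q : T, exists c : R -> T,
     [/\ {within `[0, 1]%classic, continuous c}, c 0 = p & c 1 = q]) /\
  (forall c : R -> T, {within `[0, 1]%classic, continuous c} -> c 0 = c 1 ->
   exists h : R * R -> T,
     [/\ {within `[0, 1]%classic `*` `[0, 1]%classic, continuous h},
         forall s, s \in `[0, 1] -> h (0, s) = c s,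
         forall s, s \in `[0, 1] -> h (1, s) = c 0 &
         forall a, a \in `[0, 1] -> h (a, 0) = c 0 /\ h (a, 1) = c 0]).

Section Manifold.
Context (R : realType) (n : nat) (H : riemannianManifold R n).

Definition geodesic (c : R -> H) : Prop :=
  continuous c /\
  forall t (q : H), dom (chart_at q) (c t) ->
    geodesic_eq (metric q) (to_coord (chart_at q) \o c) t.

Definition geodesic_from (p : H) (v : 'rV[R]_n) (c : R -> H) : Prop :=
  [/\ geodesic c, c 0 = p & derive1 (to_coord (chart_at p) \o c) 0 = v].

Definition geodesically_complete : Prop :=
  forall (p : H) (v : 'rV[R]_n), exists c, geodesic_from p v c.

Definition nonpositive_curvature : Prop :=
  forall (p : H) (u v : 'rV[R]_n), row_free (col_mx u v) ->
    sectional_curvature (metric p) (to_coord (chart_at p) p) u v <= 0.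

Definition hadamard : Prop :=
  [/\ geodesically_complete, simply_connected R H & nonpositive_curvature].

(* [expm p v] and [logm p q] stand for exp_p(v) and exp_p^{-1}(q); the default
   values of [xget] are never used on a Hadamard manifold. *)
Definition expm (p : H) (v : 'rV[R]_n) : H :=
  xget p [set q | exists c, geodesic_from p v c /\ c 1 = q].

Definition logm (p q : H) : 'rV[R]_n := xget 0 [set v | expm p v = q].

Definition geodesic_convex (E : set H) : Prop :=
  forall p q, E p -> E q -> forall a : R, 0 <= a <= 1 ->
    E (expm p (a *: logm p q)).

(* Functions on an open set E are represented by total functions on H: for p
   in E the notions below do not depend on the values outside E. *)
Definition diff_quotient (f : H -> R) (p : H) (w : 'rV[R]_n) (a : R) : R :=
  (f (expm p (a *: w)) - f p) / a.

Definition dirder (f : H -> R) (p : H) (w : 'rV[R]_n) : R :=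
  lim (diff_quotient f p w a @[a --> 0^'+]).

Definition dir_differentiable (f : H -> R) (p : H) : Prop :=
  forall w, cvg (diff_quotient f p w a @[a --> 0^'+]).

Definition strictly_pseudoconvex (E : set H) (f : H -> R) (p0 : H) : Prop :=
  dir_differentiable f p0 /\
  forall p, E p -> p <> p0 -> f p <= f p0 -> dirder f p0 (logm p0 p) < 0.

End Manifold.

Section IntervalValued.
Context (R : realType).

Record cinterval := CInterval { lo : R; hi : R; lo_le_hi : lo <= hi }.

Definition ctr (T : cinterval) : R := 2^-1 * (lo T + hi T).
Definition hwd (T : cinterval) : R := 2^-1 * (hi T - lo T).

Definition le_LU (T S : cinterval) : Prop := lo T <= lo S /\ hi T <= hi S.
Definition le_CW (T S : cinterval) : Prop := ctr T <= ctr S /\ hwd T <= hwd S.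

Definition interval_lt (le : cinterval -> cinterval -> Prop)
  (T S : cinterval) : Prop := le T S /\ T <> S.

Definition tuple_lt (le : cinterval -> cinterval -> Prop) (l : nat)
    (T S : 'I_l -> cinterval) : Prop :=
  (forall k, le (T k) (S k)) /\ exists h, interval_lt le (T h) (S h).

Context (n : nat) (H : riemannianManifold R n).

Definition weakly_dir_differentiable (f : H -> cinterval) (p : H) : Prop :=
  dir_differentiable (lo \o f) p /\ dir_differentiable (hi \o f) p.

Definition LU_strictly_pseudoconvex (E : set H) (f : H -> cinterval) (p0 : H) :
    Prop :=
  strictly_pseudoconvex E (lo \o f) p0 /\ strictly_pseudoconvex E (hi \o f) p0.

Definition CW_strictly_pseudoconvex (E : set H) (f : H -> cinterval) (p0 : H) :
    Prop :=
  strictly_pseudoconvex E (ctr \o f) p0 /\ strictly_pseudoconvex E (hwd \o f) p0.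

Definition feasible (E : set H) (t : nat) (psi : 'I_t -> H -> R) : set H :=
  [set p | E p /\ forall u, psi u p <= 0].

Definition pareto_optimal (le : cinterval -> cinterval -> Prop) (F : set H)
    (l : nat) (phi : 'I_l -> H -> cinterval) (p0 : H) : Prop :=
  F p0 /\ ~ exists2 p, F p & tuple_lt le (phi^~ p) (phi^~ p0).

Definition typeI_pareto_optimal := pareto_optimal le_LU.
Definition typeII_pareto_optimal := pareto_optimal le_CW.

End IntervalValued.

(* Main.v *)
Require Import Defs.
From HB Require Import structures.
From mathcomp Require Import all_boot all_order all_algebra.
From mathcomp Require Import all_classical all_reals all_analysis.

(** A strictly pseudo-convex function that does not increase from [p0] to some
    other point [p] of [E] has a strictly negative directional derivative at
    [p0] in the direction [logm p0 p].  Suppose that a feasible [p] dominated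
    [p0].  Then [p] differs from [p0], and every endpoint function of the
    objectives (respectively every centre and half-width function) has a
    negative derivative in that direction.  So does every constraint active at
    [p0], since [psi u p <= 0 = psi u p0]; the inactive constraints are killed
    by complementary slackness.  Dominance provides at least one objective,
    and its multiplier is positive, so the derivative of the Lagrangian is negative,
    against the multiplier condition: this is [lagrangian_dirder_lt0].

    Both orders on intervals enter only through a real-valued function that is
    monotone for them, so [pareto_optimal_of_multipliers] treats them together;
    it is applied to the lower endpoint for part (a) and to the centre for
    part (b). *)

Import Order.TTheory GRing.Theory Num.Theory.
Import numFieldNormedType.Exports.

Local Open Scope classical_set_scope.
Local Open Scope ring_scope.

(** The positive multiplier of the objective [h] is what makes the inequality
    strict: the constraint part alone may vanish. *)
Lemma lagrangian_dirder_lt0 (R : realType) (n : nat)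
    (H : riemannianManifold R n) (E : set H) (l t : nat)
    (psi : 'I_t -> H -> R) (p0 p : H) (f : 'I_l -> H -> R) (lam : 'I_l -> R)
    (mu : 'I_t -> R) (h : 'I_l) :
  (forall u, psi u p0 = 0 -> strictly_pseudoconvex E (psi u) p0) ->
  feasible E psi p ->
  (forall s, strictly_pseudoconvex E (f s) p0) ->
  p <> p0 -> (forall s, f s p <= f s p0) ->
  (forall s, 0 < lam s) -> (forall u, 0 <= mu u) ->
  (forall u, mu u * psi u p0 = 0) ->
  \sum_(s < l) lam s * dirder (f s) p0 (logm p0 p)
    + \sum_(u < t) mu u * dirder (psi u) p0 (logm p0 p) < 0.
Proof.
move=> psi_spc [Ep psi_le0] f_spc p_neq f_le lam_gt0 mu_ge0 slack.
have obj_lt0 s : lam s * dirder (f s) p0 (logm p0 p) < 0.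
  by rewrite pmulr_rlt0 //; case: (f_spc s) => _; apply.
have cons_le0 u : mu u * dirder (psi u) p0 (logm p0 p) <= 0.
  have /eqP := slack u; rewrite mulf_eq0 => /orP[/eqP->|/eqP psi0].
    by rewrite mul0r.
  apply: mulr_ge0_le0 => //; apply: ltW.
  by case: (psi_spc u psi0) => _; apply => //; rewrite psi0.
rewrite ltr_wnDr //; first exact: sumr_le0.
rewrite (bigD1 h) //= ltr_wnDr //.
by apply: sumr_le0 => s _; apply: ltW.
Qed.

(** Dominance for [le] is used in two ways: it bounds every [a \o phi s] at [p]
    by its value at [p0], and its strict component separates [p] from [p0] and
    supplies the objective index that makes the Lagrangian inequality strict. *)
Lemma pareto_optimal_of_multipliers (R : realType) (n : nat)
    (H : riemannianManifold R n) (E : set H) (l t : nat)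
    (phi : 'I_l -> H -> cinterval R) (psi : 'I_t -> H -> R) (p0 : H)
    (le : cinterval R -> cinterval R -> Prop) (a : cinterval R -> R) :
  (forall T S, le T S -> a T <= a S) ->
  feasible E psi p0 ->
  (forall u, psi u p0 = 0 -> strictly_pseudoconvex E (psi u) p0) ->
  (forall s, strictly_pseudoconvex E (a \o phi s) p0) ->
  (forall p, feasible E psi p ->
     exists (lam : 'I_l -> R) (mu : 'I_t -> R),
       [/\ forall s, 0 < lam s, forall u, 0 <= mu u,
           0 <= \sum_(s < l) lam s * dirder (a \o phi s) p0 (logm p0 p)
                + \sum_(u < t) mu u * dirder (psi u) p0 (logm p0 p) &
           forall u, mu u * psi u p0 = 0]) ->
  pareto_optimal le (feasible E psi) phi p0.
Proof.
move=> a_mono F0 psi_spc phi_spc multipliers; split=> //.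
move=> [p Fp [phi_le [h [_ phi_neq]]]].
have p_neq : p <> p0 by move=> pE; apply: phi_neq; rewrite pE.
have [lam [mu [lam_gt0 mu_ge0 lagr_ge0 slack]]] := multipliers p Fp.
have a_le s : (a \o phi s) p <= (a \o phi s) p0 by exact: a_mono (phi_le s).
have := lagrangian_dirder_lt0 _ _ _ _ _ _ _ _ _ _ _ _ h psi_spc Fp phi_spc p_neq a_le
  lam_gt0 mu_ge0 slack.
by rewrite ltNge lagr_ge0.
Qed.

Theorem theorem3p4 (R : realType) (n : nat) (H : riemannianManifold R n)
  (hadamardH : hadamard H)
  (E : set H) (E_nonempty : E !=set0) (E_open : open E)
  (E_convex : geodesic_convex E)
  (l t : nat) (phi : 'I_l -> H -> cinterval R) (psi : 'I_t -> H -> R)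
  (F_convex : geodesic_convex (feasible E psi))
  (pbar : H) (pbar_feasible : feasible E psi pbar)
  (psi_diff : forall u, dir_differentiable (psi u) pbar)
  (psi_spc : forall u, psi u pbar = 0 -> strictly_pseudoconvex E (psi u) pbar)
  (phi_diff : forall s, weakly_dir_differentiable (phi s) pbar) :
  ((forall s, LU_strictly_pseudoconvex E (phi s) pbar) ->
   (forall p, feasible E psi p ->
      exists (lamL lamU : 'I_l -> R) (muL muU : 'I_t -> R),
        [/\ (forall s, 0 < lamL s /\ 0 < lamU s)
              /\ (forall u, 0 <= muL u /\ 0 <= muU u),
            0 <= \sum_(s < l) lamL s * dirder (@lo R \o phi s) pbar (logm pbar p)
                 + \sum_(u < t) muL u * dirder (psi u) pbar (logm pbar p),
            0 <= \sum_(s < l) lamU s * dirder (@hi R \o phi s) pbar (logm pbar p)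
                 + \sum_(u < t) muU u * dirder (psi u) pbar (logm pbar p) &
            forall u, muL u * psi u pbar = 0 /\ muU u * psi u pbar = 0]) ->
   typeI_pareto_optimal (feasible E psi) phi pbar)
  /\
  ((forall s, CW_strictly_pseudoconvex E (phi s) pbar) ->
   (forall p, feasible E psi p ->
      exists (lamC lamW : 'I_l -> R) (muC muW : 'I_t -> R),
        [/\ (forall s, 0 < lamC s /\ 0 < lamW s)
              /\ (forall u, 0 <= muC u /\ 0 <= muW u),
            0 <= \sum_(s < l) lamC s * dirder (@ctr R \o phi s) pbar (logm pbar p)
                 + \sum_(u < t) muC u * dirder (psi u) pbar (logm pbar p),
            0 <= \sum_(s < l) lamW s * dirder (@hwd R \o phi s) pbar (logm pbar p)
                 + \sum_(u < t) muW u * dirder (psi u) pbar (logm pbar p) &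
            forall u, muC u * psi u pbar = 0 /\ muW u * psi u pbar = 0]) ->
   typeII_pareto_optimal (feasible E psi) phi pbar).
Proof.
split=> phi_spc multipliers.
- apply: (@pareto_optimal_of_multipliers _ _ _ _ _ _ _ _ _ _ (@lo R)) => //.
  + by move=> T S [].
  + by move=> s; case: (phi_spc s).
  move=> p /multipliers[lam [lam' [mu [mu' [[lam_gt0 mu_ge0] lagr_ge0 _ slack]]]]].
  exists lam, mu; split=> //.
  + by move=> s; case: (lam_gt0 s).
  + by move=> u; case: (mu_ge0 u).
  + by move=> u; case: (slack u).
- apply: (@pareto_optimal_of_multipliers _ _ _ _ _ _ _ _ _ _ (@ctr R)) => //.
  + by move=> T S [].
  + by move=> s; case: (phi_spc s).
  move=> p /multipliers[lam [lam' [mu [mu' [[lam_gt0 mu_ge0] lagr_ge0 _ slack]]]]].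
  exists lam, mu; split=> //.
  + by move=> s; case: (lam_gt0 s).
  + by move=> u; case: (mu_ge0 u).
  + by move=> u; case: (slack u).
Qed.
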